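(* The optimal constant $C_{3,\infty,\mathbf{q}}^{\mathbb{R}}$ of the generalized Bohnenblust--Hille inequality for real $3$-linear forms with multiple exponent $\mathbf{q}=(4/3,4/3,2)$, or $\mathbf{q}=(4/3,8/5,8/5)$, or $\mathbf{q}=(4/3,2,4/3)$, is $$C_{3,\infty,\mathbf{q}}^{\mathbb{R}}=2^{3/4}$$ in each of these three cases.
   Context: $\ell_\infty^n$ denotes $\mathbb{R}^n$ with the sup norm, $(e_i)$ is the canonical basis, and for an $m$-linear form $T:\ell_\infty^n\times\cdots\times\ell_\infty^n\to\mathbb{R}$ one sets $\|T\|=\sup\{|T(z^{(1)},\ldots,z^{(m)})| : \|z^{(k)}\|_\infty\le 1,\ 1\le k\le m\}$. Generalized Bohnenblust--Hille inequality: if $m\ge 2$ and $\mathbf{q}=(q_1,\ldots,q_m)\in[1,2]^m$ satisfies $\frac1{q_1}+\cdots+\frac1{q_m}=\frac{m+1}{2}$, then there is a constant $C\ge 1$ such that $$\left(\sum_{j_1=1}^{n}\left(\sum_{j_2=1}^{n}\left(\cdots\left(\sum_{j_m=1}^{n}|T(e_{j_1},\ldots,e_{j_m})|^{q_m}\right)^{\frac{q_{m-1}}{q_m}}\cdots\right)^{\frac{q_2}{q_3}}\right)^{\frac{q_1}{q_2}}\right)^{\frac1{q_1}}\le C\,\|T\|$$ for all positive integers $n$ and all $m$-linear forms $T:\ell_\infty^n\times\cdots\times\ell_\infty^n\to\mathbb{R}$. The optimal constant $C_{m,\infty,\mathbf{q}}^{\mathbb{R}}$ is the smallest such $C$. 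*)

(* Defs.v *)
From HB Require Import structures.
From mathcomp Require Import all_boot all_order all_algebra.
From mathcomp Require Import all_classical all_reals all_analysis.

Set Implicit Arguments.
Unset Strict Implicit.
Unset Printing Implicit Defensive.

Import Order.TTheory GRing.Theory Num.Theory.
Import numFieldNormedType.Exports.

Local Open Scope classical_set_scope.
Local Open Scope ring_scope.

Section BohnenblustHille.
Context {R : realType}.

Definition multilinear_form (m n : nat) (T : ('I_m -> 'rV[R]_n) -> R) : Prop :=
  forall (k : 'I_m) (z : 'I_m -> 'rV[R]_n),
    scalar (fun x : 'rV[R]_n => T (@dfwith _ (fun=> 'rV[R]_n) z k x)).

(* The library norm `|z k| on row vectors is the sup norm of l_oo^n. *)
Definition form_norm (m n : nat) (T : ('I_m -> 'rV[R]_n) -> R) : R :=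
  sup [set `|T z| | z in [set z | forall k, `|z k| <= 1]].

(* For q = (q_1, ..., q_m) this is the iterated sum
     \sum_(j_1) (\sum_(j_2) (... (\sum_(j_m) `|a j_1 ... j_m| ^ q_m)
       ^ (q_(m-1) / q_m) ...) ^ (q_2 / q_3)) ^ (q_1 / q_2),
   without the outermost power 1 / q_1; at the innermost level the default
   value 1 of head turns the exponent into q_m / 1. *)
Fixpoint mixed_sum (n m : nat) : m.-tuple R -> (m.-tuple 'I_n -> R) -> R :=
  match m return m.-tuple R -> (m.-tuple 'I_n -> R) -> R with
  | 0 => fun _ a => `|a [tuple]|
  | m'.+1 => fun q a =>
      \sum_(j < n)
        mixed_sum (behead_tuple q) (fun t : m'.-tuple 'I_n => a (cons_tuple j t))
          `^ (thead q / head 1 (behead q))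
  end.

Definition mixed_norm (n m : nat) (q : m.-tuple R) (a : m.-tuple 'I_n -> R) : R :=
  mixed_sum q a `^ (head 1 q)^-1.

Definition canonical_coef (m n : nat) (T : ('I_m -> 'rV[R]_n) -> R)
    (j : m.-tuple 'I_n) : R :=
  T (fun k => delta_mx 0 (tnth j k)).

Definition BH_constant (m : nat) (q : m.-tuple R) (C : R) : Prop :=
  1 <= C /\
  forall (n : nat) (T : ('I_m -> 'rV[R]_n) -> R),
    (0 < n)%N -> multilinear_form T ->
    mixed_norm q (canonical_coef T) <= C * form_norm T.

Definition optimal_BH_constant (m : nat) (q : m.-tuple R) (C : R) : Prop :=
  BH_constant q C /\ forall C' : R, BH_constant q C' -> C <= C'.

End BohnenblustHille.

(* Main.v *)
(* Everything reduces to q = (4/3, 4/3, 2): exchanging the last two indices by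
   Minkowski's inequality gives (4/3, 2, 4/3), and Hoelder interpolation between
   these two gives (4/3, 8/5, 8/5). For (4/3, 4/3, 2), Khinchine's inequality
   with exponent 4/3 (constant 2^(1/4)) replaces the third variable by random
   signs, and Littlewood's 4/3 inequality (constant 2^(1/2)) bounds the
   resulting bilinear forms.

   Khinchine's inequality with exponent 4/3 amounts to E|S|^(4/3) >= 1/2 for
   S = sum_i b_i e_i with sum_i b_i^2 = 1/2; it is an equality for two
   coefficients 1/2. When sum_i b_i^4 is not small, |s|^(4/3) is bounded below
   by an even polynomial that touches it at 0 and 1, and moments of S are
   computed. When sum_i b_i^4 is small, one uses the identity
     E S h(S) = 1/4 sum_i E (S - S_i) (h(S) - h(S_i)),
   S_i being S with the sign e_i flipped, for h(s) = 11/10 s - 2/5 s^(5/3): it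
   reduces the claim to a pointwise inequality between S and S_i, which is
   polynomial in their cube roots. The exponent 1 needed for Littlewood's
   inequality follows from the exponent 4/3 by interpolation with the second
   moment.

   The constant is attained by
     (w0 + w1) (x0 y0 + x0 y1 + x1 y0 - x1 y1)
     + (w0 - w1) (x2 y2 + x2 y3 + x3 y2 - x3 y3),
   which has norm 4. *)
Require Import Defs.
From mathcomp Require Import all_boot all_order all_algebra.
From mathcomp Require Import ring lra.
From mathcomp Require Import all_classical all_reals all_analysis.

Set Implicit Arguments.
Unset Strict Implicit.
Unset Printing Implicit Defensive.

Import Order.TTheory GRing.Theory Num.Theory.
Local Open Scope ring_scope.

(** * Polynomial inequalities *)

Section PolyIneq.
Context {R : realFieldType}.
Implicit Types t p n : R.

(** The polynomial of [pair_poly_ge0] on the boundary [B = A ^+ 2 / 4], divided by A. Twenty times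
    it exceeds the first square below by a quadratic with positive coefficients. *)
Lemma diag_poly_ge0 (A : R) : 0 <= A ->
  0 <= 47 / 625 - A / 3 + A ^+ 2 / 2 - 11 / 40 * A ^+ 3 + A ^+ 4 / 20.
Proof.
move=> A0; have := sqr_ge0 (A ^+ 2 - 11 / 4 * A + 97 / 80).
by have := sqr_ge0 A; nra.
Qed.

(** Bernstein basis on [a, b], up to binomial factors: nonnegative coefficients in it certify
    nonnegativity on [a, b], and [lra] can find them. *)
Lemma bernstein_ge0 (a b A : R) (m k : nat) : a <= A <= b ->
  0 <= (A - a) ^+ k * (b - A) ^+ (m - k).
Proof.
by move=> /andP[aA Ab]; rewrite mulr_ge0 ?exprn_ge0 ?subr_ge0.
Qed.

(** Nonpositivity of the discriminant, in B, of the quadratic of [pair_poly_ge0]. On each side of 5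
    / 4 the difference of the two members has nonnegative Bernstein coefficients of degree 6. *)
Lemma disc_poly_ge0 (A : R) : 7 / 10 <= A <= 9 / 5 ->
  (4 / 15 - 2 * A + 157 / 50 * A ^+ 2 - 8 / 5 * A ^+ 3) ^+ 2 <=
  16 / 5 * A ^+ 2 * (47 / 625 - 2 / 5 * A + A ^+ 2 - 53 / 50 * A ^+ 3 + 2 / 5 * A ^+ 4).
Proof.
move=> /andP[A0 A1].
have [A54|/ltW A54] := leP A (5 / 4).
- have A' : 7 / 10 <= A <= 5 / 4 by rewrite A0.
  have H k := @bernstein_ge0 (7 / 10) (5 / 4) A 6 k A'.
  have := (H 0%N, H 1%N, H 2%N, H 3%N, (H 4%N, H 5%N, H 6%N)).
  by rewrite !subnE /= => -[[[[h0 h1] h2] h3] [[h4 h5] h6]]; lra.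
- have A' : 5 / 4 <= A <= 9 / 5 by rewrite A54.
  have H k := @bernstein_ge0 (5 / 4) (9 / 5) A 6 k A'.
  have := (H 0%N, H 1%N, H 2%N, H 3%N, (H 4%N, H 5%N, H 6%N)).
  by rewrite !subnE /= => -[[[[h0 h1] h2] h3] [[h4 h5] h6]]; lra.
Qed.

(* The two sides nearly touch at t = 191 / 150. *)
Lemma minorant_poly_ge0 t : 0 <= t ->
  3 * t * (t ^+ 2 + t + 1) ^+ 2 * (453 / 2000 - t ^+ 3 / 20) <= t ^+ 2 + 2 * t + 3.
Proof.
move=> t0.
have H k : 0 <= t ^+ k * (t - 191 / 150) ^+ 2 by rewrite mulr_ge0 ?sqr_ge0 ?exprn_ge0.
have h0 := H 0%N; have h1 := H 1%N; have h2 := H 2%N; have h3 := H 3%N.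
have h4 := H 4%N; have h5 := H 5%N; have h6 := H 6%N.
nra.
Qed.

(* The left side is quadratic in B: it is decreasing in B up to A ^+ 2 / 4 for
   1 / 5 <= A <= 7 / 10 and for A >= 9 / 5, and has no real root in B in between. *)
Lemma pair_poly_ge0 (A B : R) : 0 <= A -> 0 <= B -> B <= A ^+ 2 / 4 ->
  0 <= A * (47 / 625 - 2 / 5 * A + A ^+ 2 - 53 / 50 * A ^+ 3 + 2 / 5 * A ^+ 4)
     + (4 / 15 - 2 * A + 157 / 50 * A ^+ 2 - 8 / 5 * A ^+ 3) * B + 4 / 5 * A * B ^+ 2.
Proof.
move=> A0 B0 BA.
set c := (X in A * X + _ + _); set g := (X in _ + X * B + _).
(* [g + 2 / 5 * A ^+ 3] is the derivative in B at the endpoint [A ^+ 2 / 4]; by convexity the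
   quadratic decreases up to there, where [diag_poly_ge0] applies. *)
have mono : g + 2 / 5 * A ^+ 3 <= 0 -> 0 <= A * c + g * B + 4 / 5 * A * B ^+ 2.
  move=> gA.
  have -> : A * c + g * B + 4 / 5 * A * B ^+ 2 =
     A * (47 / 625 - A / 3 + A ^+ 2 / 2 - 11 / 40 * A ^+ 3 + A ^+ 4 / 20) +
     (A ^+ 2 / 4 - B) * (4 / 5 * A * (A ^+ 2 / 4 - B) - (g + 2 / 5 * A ^+ 3)).
    by rewrite /c /g; field.
  rewrite addr_ge0 ?mulr_ge0 ?diag_poly_ge0 ?subr_ge0 //.
  apply: (le_trans gA); nra.
(* For small A the term [A * c] dominates, and crude bounds on c, g and B suffice. *)
have [A15|/ltW A15] := leP A (1 / 5).
  have cge : 2 / 125 <= c by rewrite /c; nra.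
  have gge : - (2 / 5) * A <= g by rewrite /g; nra.
  have B100 : B <= 1 / 100 by nra.
  have h1 : 0 <= B * (g + 2 / 5 * A) by apply: mulr_ge0 => //; lra.
  have h2 : 0 <= A * B ^+ 2 by rewrite mulr_ge0 ?sqr_ge0.
  have h3 : 0 <= A * (c - 2 / 125) by apply: mulr_ge0 => //; lra.
  have h4 : 0 <= A * (1 / 100 - B) by apply: mulr_ge0 => //; lra.
  lra.
have [A710|/ltW A710] := leP A (7 / 10).
  apply: mono; rewrite /g.
  have h : 0 <= (A - 1 / 5) * (7 / 10 - A) by rewrite mulr_ge0 ?subr_ge0.
  by have h' := mulr_ge0 A0 h; nra.
have [A95|/ltW A95] := leP A (9 / 5); last first.
  apply: mono; rewrite /g.
  have h : 0 <= (A - 9 / 5) * (6 / 5 * A ^+ 2 - 49 / 50 * A + 59 / 250).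
    by apply: mulr_ge0; nra.
  nra.
have D := @disc_poly_ge0 A; rewrite A710 A95 -/c -/g in D.
have {}D := D isT.
have A0' : 0 < 16 / 5 * A by lra.
rewrite -(pmulr_rge0 _ A0').
have -> : 16 / 5 * A * (A * c + g * B + 4 / 5 * A * B ^+ 2) =
  (16 / 5 * A ^+ 2 * c - g ^+ 2) + (g + 8 / 5 * A * B) ^+ 2 by field.
by rewrite addr_ge0 ?sqr_ge0 ?subr_ge0.
Qed.

(* p and n are the cube roots of S and S_i. In terms of A = p ^+ 2 + n ^+ 2 and
   b = p * n, bounding b ^+ 2 / (A + b) below by 2 / 3 * b ^+ 2 / A and b ^+ 3
   above by A * b ^+ 2 / 2 leaves the polynomial of pair_poly_ge0. The
   coefficients are rounded solutions of a linear program. *)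
Lemma pair_cert p n :
  0 <= (p ^+ 3 - n ^+ 3) ^+ 2 / 4 *
         (p ^+ 4 + n ^+ 4 - 1 + ((p ^+ 3 - n ^+ 3) ^+ 2 - 31 / 50) / 25
          + 11 / 10 * (1 - p ^+ 6 - n ^+ 6) + 2 / 5 * (p ^+ 8 + n ^+ 8))
       - 2 / 5 * ((p ^+ 3 - n ^+ 3) * (p ^+ 5 - n ^+ 5) / 4).
Proof.
set A := p ^+ 2 + n ^+ 2; set b := p * n.
have A0 : 0 <= A by rewrite addr_ge0 ?sqr_ge0.
have bA : 2 * b <= A by have := sqr_ge0 (p - n); rewrite /A /b; lra.
have bA' : - A <= 2 * b by have := sqr_ge0 (p + n); rewrite /A /b; lra.
have B4 : b ^+ 2 <= A ^+ 2 / 4 by nra.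
pose Psi := (A + b) * (A ^+ 2 - 2 * b ^+ 2 - 1 +
   (A ^+ 3 - 3 * A * b ^+ 2 - 2 * b ^+ 3 - 31 / 50) / 25 +
   11 / 10 * (1 - A ^+ 3 + 3 * A * b ^+ 2) +
   2 / 5 * ((A ^+ 2 - 2 * b ^+ 2) ^+ 2 - 2 * b ^+ 4)) - 2 / 5 * (A ^+ 2 + A * b - b ^+ 2).
rewrite [X in 0 <= X](_ : _ = (p - n) ^+ 2 * (A + b) / 4 * Psi); last first.
  by rewrite /Psi /A /b; field.
have [A00|A0'] := eqVneq A 0.
  have b00 : b = 0 by lra.
  by rewrite A00 b00 addr0 mulr0 mul0r mul0r.
have {}A0' : 0 < A by rewrite lt_neqAle eq_sym A0' A0.
have Ab : 0 <= A + b by lra.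
apply: mulr_ge0.
  by apply: divr_ge0 => //; apply: mulr_ge0 => //; exact: sqr_ge0.
rewrite -(pmulr_rge0 _ A0').
(* The last summand is exactly the slack of the two bounds on [b ^+ 2 / (A + b)] and [b ^+ 3]. *)
have -> : A * Psi = (A + b) *
    (A * (47 / 625 - 2 / 5 * A + A ^+ 2 - 53 / 50 * A ^+ 3 + 2 / 5 * A ^+ 4)
     + (4 / 15 - 2 * A + 157 / 50 * A ^+ 2 - 8 / 5 * A ^+ 3) * b ^+ 2
     + 4 / 5 * A * (b ^+ 2) ^+ 2)
  + b ^+ 2 * (A - 2 * b) * (2 / 15 + A * (A + b) / 25).
  by rewrite /Psi; field.
apply: addr_ge0.
  apply: mulr_ge0; first exact: Ab.
  by apply: pair_poly_ge0; [exact: A0|exact: sqr_ge0|exact: B4].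
apply: mulr_ge0; first by rewrite mulr_ge0 ?sqr_ge0 ?subr_ge0.
by rewrite addr_ge0 // divr_ge0 // mulr_ge0.
Qed.

End PolyIneq.

(** * Khinchine's inequality with exponent 4/3 *)

Section Rad.
Context {R : realFieldType}.
Implicit Types (b x y : R) (l : seq R) (f g h : R -> R).

(* E f(sum_i b_i e_i) for independent uniform signs e_i and l = (b_i). *)
Fixpoint rad l f : R :=
  if l is b :: l' then rad l' (fun x => (f (x + b) + f (x - b)) / 2) else f 0.

Lemma eq_rad l f g : f =1 g -> rad l f = rad l g.
Proof. by elim: l f g => [|b l IH] f g fg //=; apply: IH => x; rewrite !fg. Qed.

Lemma rad_cst l c : rad l (fun=> c) = c.
Proof. by elim: l => [|b l IH] //=; rewrite -[RHS]IH; apply: eq_rad => x; field. Qed.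

Lemma radD l f g : rad l (fun x => f x + g x) = rad l f + rad l g.
Proof.
by elim: l f g => [|b l IH] f g //=; rewrite -IH; apply: eq_rad => x; field.
Qed.

Lemma radZ l c f : rad l (fun x => c * f x) = c * rad l f.
Proof.
by elim: l f => [|b l IH] f //=; rewrite -IH; apply: eq_rad => x; field.
Qed.

Lemma rad_ge0 l f : (forall x, 0 <= f x) -> 0 <= rad l f.
Proof.
by elim: l f => [|b l IH] f f0 //=; apply: IH => x; rewrite divr_ge0 ?addr_ge0.
Qed.

Lemma le_rad l f g : (forall x, f x <= g x) -> rad l f <= rad l g.
Proof.
move=> fg; rewrite -subr_ge0 -mulN1r -radZ -radD.
by apply: rad_ge0 => x; rewrite mulN1r subr_ge0.
Qed.

(** * Even moments of Rademacher sums in terms of power sums *)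

Definition psum k l : R := \sum_(b <- l) b ^+ k.

Lemma rad_X2 l : rad l (fun x => x ^+ 2) = psum 2 l.
Proof.
elim: l => [|b l IH] /=; rewrite /psum ?big_nil ?expr0n // big_cons -/(psum 2 l).
rewrite -IH -[X in X + _](rad_cst l) -radD.
by apply: eq_rad => x; field.
Qed.

Lemma rad_X4 l : rad l (fun x => x ^+ 4) = 3 * psum 2 l ^+ 2 - 2 * psum 4 l.
Proof.
elim: l => [|b l IH] /=.
  by rewrite /psum !big_nil !expr0n /= !mulr0 subr0.
rewrite /psum !big_cons -/(psum 2 l) -/(psum 4 l).
transitivity (rad l (fun x => x ^+ 4 + (6 * b ^+ 2 * x ^+ 2 + b ^+ 4))).
  by apply: eq_rad => x; field.
by rewrite !radD radZ rad_cst IH rad_X2; ring.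
Qed.

Lemma rad_X6 l : rad l (fun x => x ^+ 6) =
  15 * psum 2 l ^+ 3 - 30 * psum 2 l * psum 4 l + 16 * psum 6 l.
Proof.
elim: l => [|b l IH] /=.
  by rewrite /psum !big_nil !expr0n /= !mulr0 subr0 addr0.
rewrite /psum !big_cons -/(psum 2 l) -/(psum 4 l) -/(psum 6 l).
transitivity (rad l (fun x => x ^+ 6 +
    (15 * b ^+ 2 * x ^+ 4 + (15 * b ^+ 4 * x ^+ 2 + b ^+ 6)))).
  by apply: eq_rad => x; field.
by rewrite !radD !radZ rad_cst IH rad_X2 rad_X4; ring.
Qed.

Lemma rad_X8 l : rad l (fun x => x ^+ 8) =
  105 * psum 2 l ^+ 4 - 420 * psum 2 l ^+ 2 * psum 4 l
  + 448 * psum 2 l * psum 6 l + 140 * psum 4 l ^+ 2 - 272 * psum 8 l.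
Proof.
elim: l => [|b l IH] /=.
  by rewrite /psum !big_nil !expr0n /= !mulr0 subr0 !addr0 subr0.
rewrite /psum !big_cons -/(psum 2 l) -/(psum 4 l) -/(psum 6 l) -/(psum 8 l).
transitivity (rad l (fun x => x ^+ 8 + (28 * b ^+ 2 * x ^+ 6 +
    (70 * b ^+ 4 * x ^+ 4 + (28 * b ^+ 6 * x ^+ 2 + b ^+ 8))))).
  by apply: eq_rad => x; field.
by rewrite !radD !radZ rad_cst IH rad_X2 rad_X4 rad_X6; ring.
Qed.

(* The sum over i of E Phi(S+, S-), where S+ and S- are the values of
   S = sum_i b_i e_i for e_i = 1 and for e_i = - 1. *)
Fixpoint flip l (Phi : R -> R -> R) : R :=
  if l is b :: l' then
    rad l' (fun x => Phi (x + b) (x - b)) +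
    flip l' (fun x y => (Phi (x + b) (y + b) + Phi (x - b) (y - b)) / 2)
  else 0.

Lemma eq_flip l Phi Psi : (forall x y, Phi x y = Psi x y) -> flip l Phi = flip l Psi.
Proof.
elim: l Phi Psi => [|b l IH] Phi Psi E //=; congr (_ + _).
  by apply: eq_rad => x.
by apply: IH => x y; rewrite !E.
Qed.

Lemma flip_ge0 l Phi : (forall x y, 0 <= Phi x y) -> 0 <= flip l Phi.
Proof.
elim: l Phi => [|b l IH] Phi P0 //=; rewrite addr_ge0 ?rad_ge0 //.
by apply: IH => x y; rewrite divr_ge0 ?addr_ge0.
Qed.

Lemma flipD l Phi Psi :
  flip l (fun x y => Phi x y + Psi x y) = flip l Phi + flip l Psi.
Proof.
elim: l Phi Psi => [|b l IH] Phi Psi /=; first by rewrite addr0.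
by rewrite radD addrACA -IH; congr (_ + _); apply: eq_flip => x y; field.
Qed.

Lemma flipZ l c Phi : flip l (fun x y => c * Phi x y) = c * flip l Phi.
Proof.
elim: l Phi => [|b l IH] Phi /=; first by rewrite mulr0.
by rewrite radZ mulrDr -IH; congr (_ + _); apply: eq_flip => x y; field.
Qed.

(** Flipping the sign [e_i] changes S by [2 b_i], so the weight is [b_i ^+ 2], while [f x + f y] has
    mean [2 E f(S)]. *)
Lemma flip_sqr l f :
  flip l (fun x y => (x - y) ^+ 2 / 4 * (f x + f y)) = 2 * psum 2 l * rad l f.
Proof.
elim: l f => [|b l IH] f /=; first by rewrite /psum big_nil mulr0 mul0r.
rewrite /psum big_cons -/(psum 2 l).
transitivity (2 * b ^+ 2 * rad l (fun x => (f (x + b) + f (x - b)) / 2) +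
    flip l (fun x y => (x - y) ^+ 2 / 4 *
      ((f (x + b) + f (x - b)) / 2 + (f (y + b) + f (y - b)) / 2))).
  congr (_ + _); last by apply: eq_flip => x y; field.
  by rewrite -radZ; apply: eq_rad => x; field.
by rewrite IH; ring.
Qed.

Lemma flip_X4 l : flip l (fun x y => (x - y) ^+ 4) = 16 * psum 4 l.
Proof.
elim: l => [|b l IH] /=; first by rewrite /psum big_nil mulr0.
rewrite /psum big_cons -/(psum 4 l) mulrDr -IH.
congr (_ + _); last by apply: eq_flip => x y; field.
by rewrite -[RHS](rad_cst l); apply: eq_rad => x; ring.
Qed.

(** Averaging over [e_i] alone turns [E (b_i e_i h(S))] into the mean of [b_i (h(S+) - h(S-)) / 2],
    and [b_i] is half of [S+ - S-]. *)
Lemma stein l h :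
  flip l (fun x y => (x - y) * (h x - h y) / 4) = rad l (fun x => x * h x).
Proof.
elim: l h => [|b l IH] h /=; first by rewrite mul0r.
transitivity (rad l (fun x => b * ((h (x + b) - h (x - b)) / 2)) +
    flip l (fun x y => (x - y) * ((h (x + b) + h (x - b)) / 2 -
      (h (y + b) + h (y - b)) / 2) / 4)).
  congr (_ + _); last by apply: eq_flip => x y; field.
  by apply: eq_rad => x; field.
by rewrite IH -radD; apply: eq_rad => x; field.
Qed.

(** * Khinchine's bound in three ranges of the fourth power sum *)

Section CubeRoot.
Context (cb : R -> R) (cbK : forall x, cb x ^+ 3 = x).
Context (l : seq R) (l1 : psum 2 l = 1 / 2).

(** The minorant has mean 5/12 + 2/3 [psum 4 l], which reaches 1/2 exactly at [psum 4 l = 1 / 8],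
    the value for two coefficients 1/2. *)
Lemma large_psum4 : 1 / 8 <= psum 4 l -> 1 / 2 <= rad l (fun x => cb x ^+ 4).
Proof.
move=> l2.
have : rad l (fun x => 4 / 3 * x ^+ 2 + (-1 / 3) * x ^+ 4) <=
    rad l (fun x => cb x ^+ 4).
  apply: le_rad => x; rewrite -(cbK x) -!exprM cbK -subr_ge0.
  set t := cb x ^+ 2.
  rewrite [X in 0 <= X](_ : _ = t ^+ 2 * (t - 1) ^+ 2 * ((t + 1) ^+ 2 + 2) / 3); last first.
    by rewrite /t; field.
  apply: divr_ge0 => //; apply: mulr_ge0; last by rewrite addr_ge0 ?sqr_ge0.
  by apply: mulr_ge0; exact: sqr_ge0.
by rewrite radD !radZ rad_X2 rad_X4 l1; lra.
Qed.

(** The expanded sum of [(b ^+ k * (2 * b ^+ 2 - c)) ^+ 2]. It bounds a power sum below by two lower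
    ones, sharply when every nonzero [b ^+ 2] equals c / 2. *)
Lemma psum_quad k c :
  0 <= 4 * psum (k.+1.*2.+2) l - 4 * c * psum k.+1.*2 l + c ^+ 2 * psum k.*2 l.
Proof.
rewrite /psum -mulrA !mulr_sumr -sumrB -big_split /=; apply: sumr_ge0 => b _.
have -> : 4 * b ^+ k.+1.*2.+2 - 4 * (c * b ^+ k.+1.*2) + c ^+ 2 * b ^+ k.*2 =
    (b ^+ k * (2 * b ^+ 2 - c)) ^+ 2.
  by rewrite doubleS -muln2 !exprS exprM; ring.
exact: sqr_ge0.
Qed.

Lemma medium_psum4 : 31 / 400 <= psum 4 l <= 1 / 8 ->
  1 / 2 <= rad l (fun x => cb x ^+ 4).
Proof.
move=> /andP[l2 l2'].
(* The minorant of [large_psum4] plus [x ^+ 2 * (x ^+ 2 - 1) ^+ 2 * (453 / 2000 - x ^+ 2 / 20)],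
   which keeps the contact at 0 and 1. *)
have : rad l (fun x => (4 / 3 + 453 / 2000) * x ^+ 2 +
      ((- 1 / 3 - 453 / 1000 - 1 / 20) * x ^+ 4 +
       ((453 / 2000 + 1 / 10) * x ^+ 6 + (- 1 / 20) * x ^+ 8))) <=
    rad l (fun x => cb x ^+ 4).
  apply: le_rad => x; rewrite -(cbK x) -!exprM cbK -subr_ge0.
  set t := cb x ^+ 2.
  rewrite [X in 0 <= X](_ : _ = t ^+ 2 * (t - 1) ^+ 2 / 3 * (t ^+ 2 + 2 * t + 3 -
     3 * t * (t ^+ 2 + t + 1) ^+ 2 * (453 / 2000 - t ^+ 3 / 20))); last first.
    by rewrite /t; field.
  apply: mulr_ge0; last by rewrite subr_ge0 minorant_poly_ge0 ?sqr_ge0.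
  by apply: divr_ge0 => //; apply: mulr_ge0; exact: sqr_ge0.
apply: le_trans.
rewrite !radD !radZ rad_X2 rad_X4 rad_X6 rad_X8 l1.
set x := psum 4 l in l2 l2' *.
have [x4|/ltW x4] := leP x (747 / 6800).
  (* In the mean, [psum 6 l] has coefficient -747/125 and [psum 8 l] has 68/5; the parameter
     747/1700 is the ratio that cancels [psum 6 l]. *)
  have /= := psum_quad 2 (747 / 1700); rewrite -/x => q8.
  by nra.
(* Now [4 * x] is at least 747/1700, so [psum 6 l] is left with a nonnegative coefficient and is
   bounded below by [2 * x ^+ 2], which is Cauchy-Schwarz. *)
have /= := psum_quad 2 (4 * x); rewrite -/x => q8.
have /= := psum_quad 1 (4 * x); rewrite -/x l1 => q6.
have q6' : 0 <= (x - 747 / 6800) * (4 * psum 6 l - 4 * (4 * x) * x + (4 * x) ^+ 2 * (1 / 2)).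
  by rewrite mulr_ge0 ?subr_ge0.
have xx : 0 <= (x - 747 / 6800) * (1 / 8 - x) by rewrite mulr_ge0 ?subr_ge0.
by nra.
Qed.

Lemma small_psum4 : psum 4 l <= 31 / 400 -> 1 / 2 <= rad l (fun x => cb x ^+ 4).
Proof.
move=> l2.
(* This is [|x|^(4/3) - x h(x)] minus a constant, for h(s) = 11/10 s - 2/5 s^(5/3). The constant is
   1/2 + 4/25 * 31/400, where 4/25 [psum 4 l] is the contribution of the fourth powers of
   [x - y]. *)
pose f x := cb x ^+ 4 + (-11 / 10) * x ^+ 2 + (2 / 5 * (x * cb x ^+ 5) + - (1281 / 2500)).
have : 0 <= flip l (fun x y => (x - y) ^+ 2 / 4 * (f x + f y)
   + (1 / 100 * (x - y) ^+ 4 + (11 / 10 * ((x - y) * (x - y) / 4)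
   + (-2 / 5) * ((x - y) * (cb x ^+ 5 - cb y ^+ 5) / 4)))).
  apply: flip_ge0 => x y.
  rewrite [X in 0 <= X](_ : _ = (x - y) ^+ 2 / 4 *
         (cb x ^+ 4 + cb y ^+ 4 - 1 + ((x - y) ^+ 2 - 31 / 50) / 25
          + 11 / 10 * (1 - x ^+ 2 - y ^+ 2) + 2 / 5 * (x * cb x ^+ 5 + y * cb y ^+ 5))
       - 2 / 5 * ((x - y) * (cb x ^+ 5 - cb y ^+ 5) / 4)); last by rewrite /f; field.
  have := pair_cert (cb x) (cb y).
  by rewrite (exprM _ 3 2) (exprM _ 3 2) (exprD _ 3 5) (exprD _ 3 5) !cbK.
rewrite !flipD flip_sqr !flipZ flip_X4 !stein l1 /f !radD !radZ rad_cst.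
rewrite [rad l (fun x => x * x)](_ : _ = psum 2 l); last first.
  by rewrite -rad_X2; apply: eq_rad => x; rewrite expr2.
rewrite l1; lra.
Qed.

Lemma khinchine_43 : 1 / 2 <= rad l (fun x => cb x ^+ 4).
Proof.
have [/small_psum4//|/ltW h1] := leP (psum 4 l) (31 / 400).
have [h2|/ltW/large_psum4//] := leP (psum 4 l) (1 / 8).
by apply: medium_psum4; rewrite h1.
Qed.
End CubeRoot.
End Rad.

(** * Real powers, Hoelder and Minkowski *)

Section PowR.
Context {R : realType}.
Implicit Types (a b r x y : R).

Lemma le_powR r x y : 0 <= r -> 0 <= x -> x <= y -> x `^ r <= y `^ r.
Proof.
by move=> r0 x0 xy; apply: ge0_ler_powR; rewrite ?nnegrE // (le_trans x0).
Qed.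

Lemma powR_mul_compl a b x : 0 <= x -> a + b = 1 -> x `^ a * x `^ b = x.
Proof.
by move=> x0 ab; rewrite -powRD ?ab ?oner_eq0 // powRr1.
Qed.

(** Hoelder with conjugate exponents 1/a and 1/b: Young's inequality is summed after dividing by the
    totals X and Y, whence the separate cases of a zero total. *)
Lemma hoelder_sum (I : finType) (a b : R) (x y : I -> R) :
  0 < a -> 0 < b -> a + b = 1 -> (forall i, 0 <= x i) -> (forall i, 0 <= y i) ->
  \sum_i x i `^ a * y i `^ b <= (\sum_i x i) `^ a * (\sum_i y i) `^ b.
Proof.
move=> a0 b0 ab x0 y0.
set X := \sum_i x i; set Y := \sum_i y i.
have X0 : 0 <= X by apply: sumr_ge0.
have Y0 : 0 <= Y by apply: sumr_ge0.
have [X00|X1] := eqVneq X 0.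
  rewrite big1 ?mulr_ge0 ?powR_ge0 // => i _.
  have -> : x i = 0 by apply: (psumr_eq0P (fun i _ => x0 i) X00).
  by rewrite powR0 ?mul0r ?gt_eqF.
have [Y00|Y1] := eqVneq Y 0.
  rewrite big1 ?mulr_ge0 ?powR_ge0 // => i _.
  have -> : y i = 0 by apply: (psumr_eq0P (fun i _ => y0 i) Y00).
  by rewrite (powR0 (_ : b != 0)) ?mulr0 ?gt_eqF.
have young i : x i `^ a * y i `^ b <=
    (X `^ a * Y `^ b) * (a * (x i / X) + b * (y i / Y)).
  have -> : x i `^ a * y i `^ b =
      (X `^ a * Y `^ b) * ((x i / X) `^ a * (y i / Y) `^ b).
    by rewrite mulrACA -!powRM ?divr_ge0 // !(mulrC _ (_ / _)) !divfK.
  rewrite ler_wpM2l ?mulr_ge0 ?powR_ge0 //.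
  have := @conjugate_powR R ((x i / X) `^ a) ((y i / Y) `^ b) a^-1 b^-1.
  rewrite -!powRrM !mulfV ?gt_eqF // !powRr1 ?divr_ge0 // !invrK.
  by rewrite (mulrC _ a) (mulrC _ b); apply; rewrite ?powR_ge0 ?invr_gt0.
apply: (le_trans (ler_sum _ (fun i _ => young i))).
rewrite -mulr_sumr big_split /= -!mulr_sumr -!mulr_suml -/X -/Y !divff //.
by rewrite !mulr1 ab mulr1.
Qed.

Lemma minkowski_sum (I J : finType) r (v : I -> J -> R) :
  1 < r -> (forall i j, 0 <= v i j) ->
  (\sum_i (\sum_j v i j) `^ r) `^ r^-1 <= \sum_j (\sum_i v i j `^ r) `^ r^-1.
Proof.
move=> r1 v0.
have r0 : 0 < r by apply: lt_trans r1.
have rV0 : 0 < r^-1 by rewrite invr_gt0.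
have rV1 : 0 < 1 - r^-1 by rewrite subr_gt0 invf_lt1.
have W0 i : 0 <= \sum_j v i j by apply: sumr_ge0.
set Z := \sum_i _; set S := \sum_j _.
have Z0 : 0 <= Z by apply: sumr_ge0 => i _; exact: powR_ge0.
(* One factor of the r-th power of the inner sum is expanded, and Hoelder is applied over i for each
   j. *)
have ZS : Z <= S * Z `^ (1 - r^-1).
  have {1}-> : Z = \sum_j \sum_i (v i j `^ r) `^ r^-1 *
      ((\sum_j v i j) `^ r) `^ (1 - r^-1).
    rewrite exchange_big; apply: eq_bigr => i _ /=.
    rewrite -mulr_suml -[LHS]mulr_powRB1 //; congr (_ * _).
      by apply: eq_bigr => j _; rewrite -powRrM mulfV ?gt_eqF // powRr1.
    by rewrite -powRrM mulrBr mulr1 mulfV ?gt_eqF.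
  rewrite mulr_suml; apply: ler_sum => j _.
  by apply: hoelder_sum => // [|i|i]; rewrite ?powR_ge0 // addrC subrK.
have [->|Z1] := eqVneq Z 0.
  by rewrite powR0 ?gt_eqF // sumr_ge0 // => j _; exact: powR_ge0.
have Zp : 0 < Z `^ (1 - r^-1) by rewrite powR_gt0 // lt_neqAle eq_sym Z1 Z0.
rewrite -(ler_pM2r Zp); apply: le_trans ZS.
by rewrite powR_mul_compl // addrC subrK.
Qed.

End PowR.

(** * Khinchine's inequality for real powers, with exponents 4/3 and 1 *)

Section RealKhinchine.
Context {R : realType}.
Implicit Types (x c : R) (l : seq R).

Let cb x : R := Num.sg x * `|x| `^ 3^-1.

Let cbK x : cb x ^+ 3 = x.
Proof.
rewrite /cb exprMn -[(_ `^ _) ^+ 3]powR_mulrn ?powR_ge0 // -powRrM mulVf ?pnatr_eq0 // powRr1 //.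
have [->|x0] := eqVneq x 0; first by rewrite sgr0 expr0n mul0r.
by rewrite exprS sqr_sg x0 mulr1 -numEsg.
Qed.

Let cb4 x : cb x ^+ 4 = `|x| `^ (4 / 3).
Proof.
have -> : cb x ^+ 4 = `|cb x| ^+ 4 by rewrite -normrX ger0_norm // exprn_even_ge0.
rewrite -{2}(cbK x) normrX -[X in X `^ _]powR_mulrn // -powRrM.
by rewrite -powR_mulrn //; congr (_ `^ _); field.
Qed.

Lemma rad_map c l (f : R -> R) :
  rad [seq c * b | b <- l] f = rad l (fun x => f (c * x)).
Proof.
elim: l f => [|b l IH] f /=; first by rewrite mulr0.
by rewrite IH; apply: eq_rad => x; rewrite mulrDr mulrBr.
Qed.

Lemma khinchine_unit l : psum 2 l = 1 / 2 -> 
  1 / 2 <= rad l (fun x => `|x| `^ (4 / 3)) /\ 1 / 2 <= rad l (fun x => `|x|).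
Proof.
move=> l1; have H := khinchine_43 cbK l1.
split; first by apply: le_trans H _; apply: le_rad => x; rewrite cb4.
(* Exponent 1: this minorant of [|x|] touches it at 0 and 1, and its mean is at least 3/4 - 1/4. *)
have : rad l (fun x => 3 / 2 * cb x ^+ 4 + (- 1 / 2) * x ^+ 2) <= rad l (fun x => `|x|).
  apply: le_rad => x; rewrite -{2 3}(cbK x) normrX -subr_ge0.
  have -> : cb x ^+ 4 = `|cb x| ^+ 4 by rewrite -normrX ger0_norm // exprn_even_ge0.
  have -> : (cb x ^+ 3) ^+ 2 = `|cb x| ^+ 6.
    by rewrite -exprM -normrX ger0_norm // exprn_even_ge0.
  set p := `|cb x|.
  rewrite [X in 0 <= X](_ : _ = p ^+ 3 * (p - 1) ^+ 2 * (p + 2) / 2); last by field.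
  have p0 : 0 <= p by exact: normr_ge0.
  apply: divr_ge0 => //; apply: mulr_ge0; last lra.
  by apply: mulr_ge0; [exact: exprn_ge0|exact: sqr_ge0].
by rewrite radD !radZ rad_X2 l1; lra.
Qed.

Lemma psum2_ge0 l : 0 <= psum 2 l.
Proof. by apply: sumr_ge0 => b _; exact: sqr_ge0. Qed.

(** By homogeneity l is rescaled to [psum 2 l = 1 / 2], where the claim reads [E |S|^r >= 1/2]. *)
Lemma khinchine_scale l r : 0 < r ->
  (forall l', psum 2 l' = 1 / 2 -> 1 / 2 <= rad l' (fun x => `|x| `^ r)) ->
  psum 2 l `^ (r / 2) <= 2 `^ (1 - r / 2) * rad l (fun x => `|x| `^ r).
Proof.
move=> r0 H.
have [->|l0] := eqVneq (psum 2 l) 0.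
  rewrite powR0 ?mulf_neq0 ?gt_eqF //.
  by rewrite mulr_ge0 ?powR_ge0 // rad_ge0 // => x; exact: powR_ge0.
have lp : 0 < psum 2 l by rewrite lt_neqAle eq_sym l0 psum2_ge0.
pose c := (2 * psum 2 l) `^ (- 2^-1).
have c0 : 0 < c by rewrite powR_gt0 // mulr_gt0.
have c2 : c ^+ 2 = (2 * psum 2 l)^-1.
  rewrite -powR_mulrn ?(ltW c0) // /c -powRrM mulNr mulVf ?pnatr_eq0 //.
  by rewrite powR_inv1 // mulr_ge0 // ltW.
have := H [seq c * b | b <- l].
have -> : psum 2 [seq c * b | b <- l] = 1 / 2.
  rewrite /psum big_map; under eq_bigr do rewrite exprMn.
  by rewrite -mulr_sumr c2 -/(psum 2 l); field.
move=> /(_ erefl); rewrite rad_map.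
have -> : rad l (fun x => `|c * x| `^ r) = c `^ r * rad l (fun x => `|x| `^ r).
  rewrite -radZ; apply: eq_rad => x.
  by rewrite normrM powRM // (gtr0_norm c0).
have -> : c `^ r = ((2 * psum 2 l) `^ (r / 2))^-1.
  by rewrite /c -powRrM -powRN mulNr [2^-1 * r]mulrC.
rewrite [X in _ <= X]mulrC ler_pdivlMr ?powR_gt0 ?mulr_gt0 // powRM ?(ltW lp) //.
rewrite powRB ?powRr1 //; last by apply/implyP; rewrite pnatr_eq0.
move=> h; rewrite [X in _ <= X]mulrAC ler_pdivlMr ?powR_gt0 //; lra.
Qed.

Lemma khinchine43 l :
  psum 2 l `^ (2 / 3) <= 2 `^ (1 / 3) * rad l (fun x => `|x| `^ (4 / 3)).
Proof.
have := @khinchine_scale l (4 / 3); rewrite (_ : 4 / 3 / 2 = 2 / 3); last by field.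
rewrite (_ : 1 - 2 / 3 = 1 / 3); last by field.
apply=> [|l' /khinchine_unit[]//]; lra.
Qed.

Lemma khinchine1 l : psum 2 l `^ 2^-1 <= 2 `^ 2^-1 * rad l (fun x => `|x|).
Proof.
have := @khinchine_scale l 1; rewrite (_ : 1 - 1 / 2 = 2^-1); last by field.
rewrite [X in psum 2 l `^ X]div1r.
rewrite (@eq_rad _ l (fun x => `|x| `^ 1) (fun x => `|x|)); last by move=> x; rewrite powRr1.
apply=> // l' /khinchine_unit[_ h].
by apply: le_trans h _; apply: le_rad => x; rewrite powRr1.
Qed.

End RealKhinchine.

(** * Littlewood's inequality and trilinear arrays *)

Section Forms.
Context {R : realType}.

(** An average over signs is at most the largest value. The induction fixes one sign at a time, and
    all i share the same signs. *)
Lemma sum_rad_le (I : finType) (K : eqType) (ks : seq K) (b : I -> K -> R)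
    (f : I -> R -> R) (M : R) : uniq ks ->
  (forall e : K -> R, (forall k, `|e k| <= 1) ->
     \sum_i f i (\sum_(k <- ks) b i k * e k) <= M) ->
  \sum_i rad [seq b i k | k <- ks] (f i) <= M.
Proof.
elim: ks f => [|k ks IH] f /= => [_|/andP[kks uks]] H.
  have := H (fun=> 0); under eq_bigr do rewrite big_nil.
  by apply=> k; rewrite normr0.
apply: IH => // e e1.
(* By [uniq], changing e at k leaves the sum over the remaining indices unchanged. *)
pose e' s k' := if k' == k then s else e k'.
have E s : `|s| = 1 -> \sum_i f i (\sum_(k' <- ks) b i k' * e k' + b i k * s) <= M.
  move=> s1; rewrite (eq_bigr (fun i => f i (\sum_(k' <- k :: ks) b i k' * e' s k'))).
    by apply: H => k'; rewrite /e'; case: ifP; rewrite ?s1.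
  move=> i _; rewrite big_cons /e' eqxx addrC; congr (f i (_ + _)).
  by apply: eq_big_seq => k' k'ks; case: eqP => // k'k; rewrite -k'k k'ks in kks.
rewrite -mulr_suml big_split /= ler_pdivrMr // mulr_natr mulr2n lerD //.
  by apply: le_trans (E 1 _); rewrite ?normr1 //; apply: ler_sum => i _; rewrite mulr1.
by apply: le_trans (E (- 1) _); rewrite ?normrN1 //; apply: ler_sum => i _; rewrite mulrN1.
Qed.

Let sgn (x : R) : R := if x < 0 then -1 else 1.
Let sgn_norm x : `|sgn x| <= 1.
Proof. by rewrite /sgn; case: ifP; rewrite ?normrN normr1. Qed.
Let mul_sgn x : x * sgn x = `|x|.
Proof.
rewrite /sgn; case: ltP => x0; first by rewrite mulrN1 ltr0_norm.
by rewrite mulr1 ger0_norm.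
Qed.

Lemma psum2_map (J : finType) (c : J -> R) :
  psum 2 [seq c j | j <- index_enum J] = \sum_j `|c j| `^ 2.
Proof.
rewrite /psum big_map; apply: eq_bigr => j _.
by rewrite powR_mulrn // real_normK // num_real.
Qed.

(** Khinchine with exponent 1 replaces each row norm by an average over signs in j; for fixed signs,
    the signs of the row sums serve as the other variable. *)
Lemma littlewood_rows (I J : finType) (a : I -> J -> R) (M : R) :
  (forall (e : I -> R) (e' : J -> R), (forall i, `|e i| <= 1) ->
     (forall j, `|e' j| <= 1) -> `|\sum_i \sum_j a i j * e i * e' j| <= M) ->
  \sum_i (\sum_j `|a i j| `^ 2) `^ 2^-1 <= 2 `^ 2^-1 * M.
Proof.
move=> H.
apply: (@le_trans _ _ (\sum_i 2 `^ 2^-1 *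
    rad [seq a i j | j <- index_enum J] (fun x => `|x|))).
  by apply: ler_sum => i _; rewrite -psum2_map khinchine1.
rewrite -mulr_sumr ler_wpM2l ?powR_ge0 //.
apply: sum_rad_le => [|e' e'1]; first exact: index_enum_uniq.
pose e i := sgn (\sum_j a i j * e' j).
apply: le_trans (H e e' _ e'1) => [|i]; last exact: sgn_norm.
apply: le_trans (ler_norm _); apply: ler_sum => i _.
rewrite -mul_sgn mulr_suml; apply: ler_sum => j _.
by rewrite mulrAC.
Qed.

(** Hoelder interpolates between the sum A of the row norms and the mixed norm with inner exponent 1
    and outer exponent 2, which Minkowski bounds by the sum B of the column norms. *)
Lemma littlewood (I J : finType) (a : I -> J -> R) (M : R) :
  (forall (e : I -> R) (e' : J -> R), (forall i, `|e i| <= 1) ->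
     (forall j, `|e' j| <= 1) -> `|\sum_i \sum_j a i j * e i * e' j| <= M) ->
  \sum_i \sum_j `|a i j| `^ (4 / 3) <= 2 `^ (2 / 3) * M `^ (4 / 3).
Proof.
move=> H.
have M0 : 0 <= M.
  by apply: le_trans (H (fun=> 0) (fun=> 0) _ _) => // *; rewrite normr0.
have rows := littlewood_rows H.
have cols : \sum_j (\sum_i `|a i j| `^ 2) `^ 2^-1 <= 2 `^ 2^-1 * M.
  apply: (@littlewood_rows _ _ (fun j i => a i j)) => e e' e1 e'1.
  apply: le_trans (H e' e e'1 e1); rewrite exchange_big /=.
  rewrite le_eqVlt; apply/orP; left; apply/eqP; congr `|_|.
  by apply: eq_bigr => i _; apply: eq_bigr => j _; rewrite mulrAC.
set A := \sum_i _ in rows; set B := \sum_j _ in cols.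
have A0 : 0 <= A by apply: sumr_ge0 => i _; exact: powR_ge0.
have B0 : 0 <= B by apply: sumr_ge0 => i _; exact: powR_ge0.
have h13 : 0 < (1 / 3 : R) by lra.
have h23 : 0 < (2 / 3 : R) by lra.
apply: (@le_trans _ _ (A `^ (2 / 3) * B `^ (2 / 3))).
  apply: (@le_trans _ _ (\sum_i ((\sum_j `|a i j| `^ 2) `^ 2^-1) `^ (2 / 3) *
      ((\sum_j `|a i j|) `^ 2) `^ (1 / 3))).
    apply: ler_sum => i _.
    rewrite -!powRrM (_ : 2^-1 * (2 / 3) = 1 / 3); last by field.
    rewrite (_ : 2 * (1 / 3) = 2 / 3); last by field.
    apply: (le_trans _ (hoelder_sum h13 h23 _ _ _)) => [||j|//].
    - apply: ler_sum => j _; rewrite -powRrM -powRD; last by apply/implyP; lra.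
      by rewrite (_ : 2 * (1 / 3) + 2 / 3 = 4 / 3) //; field.
    - by field.
    - exact: powR_ge0.
  apply: (le_trans (hoelder_sum h23 h13 _ _ _)) => [|i|i|]; rewrite ?powR_ge0 //.
    by field.
  rewrite ler_wpM2l ?powR_ge0 //.
  rewrite (_ : 1 / 3 = 2^-1 * (2 / 3)); last by field.
  rewrite powRrM; apply: le_powR; [exact: ltW|exact: powR_ge0|].
  by apply: minkowski_sum; rewrite ?ltr1n.
have -> : 2 `^ (2 / 3) * M `^ (4 / 3) = (2 `^ 2^-1 * M) `^ (2 / 3) * (2 `^ 2^-1 * M) `^ (2 / 3).
  rewrite -powRD; last by apply/implyP; lra.
  rewrite powRM ?powR_ge0 // -powRrM.
  by congr (_ `^ _ * _ `^ _); field.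
by rewrite ler_pM ?powR_ge0 // le_powR // ltW.
Qed.

Definition bounded_form (I J K : finType) (a : I -> J -> K -> R) (M : R) :=
  forall (e : I -> R) (e' : J -> R) (e'' : K -> R),
    (forall i, `|e i| <= 1) -> (forall j, `|e' j| <= 1) ->
    (forall k, `|e'' k| <= 1) ->
    `|\sum_i \sum_j \sum_k a i j k * e i * e' j * e'' k| <= M.

Lemma trilinear_43_43_2 (I J K : finType) (a : I -> J -> K -> R) (M : R) :
  bounded_form a M ->
  \sum_i \sum_j (\sum_k `|a i j k| `^ 2) `^ (2 / 3) <= 2 * M `^ (4 / 3).
Proof.
move=> H.
(* The Khinchine constant 2^(1/4) and the Littlewood constant 2^(1/2), both raised to the power
   4/3. *)
have -> : 2 * M `^ (4 / 3) = 2 `^ (1 / 3) * (2 `^ (2 / 3) * M `^ (4 / 3)).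
  rewrite mulrA -powRD; last by apply/implyP; rewrite pnatr_eq0.
  by rewrite (_ : 1 / 3 + 2 / 3 = 1) ?powRr1 //; field.
rewrite pair_bigA /=.
apply: (@le_trans _ _ (\sum_(p : I * J) 2 `^ (1 / 3) *
    rad [seq a p.1 p.2 k | k <- index_enum K] (fun x => `|x| `^ (4 / 3)))).
  by apply: ler_sum => p _; rewrite -psum2_map khinchine43.
rewrite -mulr_sumr ler_wpM2l ?powR_ge0 //.
apply: (@sum_rad_le _ _ _ (fun p k => a p.1 p.2 k)) => [|e'' e1]; first exact: index_enum_uniq.
rewrite -(pair_bigA _ (fun i j => `|\sum_k a i j k * e'' k| `^ (4 / 3))) /=.
apply: littlewood => e e' e0 e'0.
apply: le_trans (H e e' e'' e0 e'0 e1).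
rewrite le_eqVlt; apply/orP; left; apply/eqP; congr `|_|.
apply: eq_bigr => i _; apply: eq_bigr => j _.
by rewrite !mulr_suml; apply: eq_bigr => k _; ring.
Qed.

Lemma bounded_form_swap (I J K : finType) (a : I -> J -> K -> R) (M : R) :
  bounded_form a M -> bounded_form (fun i k j => a i j k) M.
Proof.
move=> H e e' e'' e0 e1 e2; apply: le_trans (H e e'' e' e0 e2 e1).
rewrite le_eqVlt; apply/orP; left; apply/eqP; congr `|_|.
apply: eq_bigr => i _; rewrite exchange_big; apply: eq_bigr => j _.
by apply: eq_bigr => k _; rewrite mulrAC.
Qed.

(** Minkowski with exponent 3/2 for the entries [|a j k|^(4/3)]. *)
Lemma mixed_swap (J K : finType) (a : J -> K -> R) :
  (\sum_j (\sum_k `|a j k| `^ (4 / 3)) `^ (3 / 2)) `^ (2 / 3) <=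
  \sum_k (\sum_j `|a j k| `^ 2) `^ (2 / 3).
Proof.
have r1 : 1 < (3 / 2 : R) by lra.
have E : (2 / 3 : R) = (3 / 2)^-1 by field.
have E' : (4 / 3 * (3 / 2) : R) = 2 by field.
move: E E' r1; move: (3 / 2) (2 / 3) => r _ -> E' r1.
apply: le_trans (minkowski_sum r1 _) _ => [j k|]; first exact: powR_ge0.
apply: ler_sum => k _; under eq_bigr do rewrite -powRrM E'.
exact: lexx.
Qed.

Lemma trilinear_43_2_43 (I J K : finType) (a : I -> J -> K -> R) (M : R) :
  bounded_form a M ->
  \sum_i (\sum_j (\sum_k `|a i j k| `^ (4 / 3)) `^ (3 / 2)) `^ (2 / 3)
    <= 2 * M `^ (4 / 3).
Proof.
move=> /bounded_form_swap/trilinear_43_43_2; apply: le_trans.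
by apply: ler_sum => i _; exact: mixed_swap.
Qed.

Lemma hoelder_powR (I : finType) (a b c d r s : R) (x y : I -> R) :
  0 < a -> 0 < b -> a + b = 1 -> r = c * a -> s = d * b ->
  \sum_i x i `^ r * y i `^ s <=
    (\sum_i x i `^ c) `^ a * (\sum_i y i `^ d) `^ b.
Proof.
move=> a0 b0 ab -> ->.
apply: le_trans (hoelder_sum a0 b0 ab _ _) => [|i|i]; rewrite ?powR_ge0 //.
by under eq_bigr do rewrite !powRrM.
Qed.

(** The inequality of arithmetic and geometric means for x and y^(2/3). It makes the interpolated
    bound additive, so that summing over the first index is immediate. *)
Lemma powR_mean (x y : R) : 0 <= x -> 0 <= y ->
  (x `^ (3 / 5) * y `^ (2 / 5)) `^ (5 / 6) <= (x + y `^ (2 / 3)) / 2.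
Proof.
move=> x0 y0; have z0 : 0 <= y `^ (2 / 3) by exact: powR_ge0.
rewrite powRM; [|exact: powR_ge0|exact: powR_ge0].
have -> : (x `^ (3 / 5)) `^ (5 / 6) = Num.sqrt x.
  by rewrite -powRrM -powR12_sqrt //; congr (_ `^ _); field.
have -> : (y `^ (2 / 5)) `^ (5 / 6) = Num.sqrt (y `^ (2 / 3)).
  by rewrite -powRrM -powR12_sqrt // -powRrM; congr (_ `^ _); field.
move: (y `^ (2 / 3)) z0 => z z0.
have := sqr_ge0 (Num.sqrt x - Num.sqrt z).
rewrite sqrrB !sqr_sqrtr //; lra.
Qed.

(** In reciprocal exponents, (8/5, 8/5) is the midpoint of (4/3, 2) and (2, 4/3); Hoelder is applied
    first over k, then over j. *)
Lemma mixed_interp (J K : finType) (a : J -> K -> R) :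
  (\sum_j \sum_k `|a j k| `^ (8 / 5)) `^ (5 / 6) <=
  (\sum_j (\sum_k `|a j k| `^ 2) `^ (2 / 3) +
   (\sum_j (\sum_k `|a j k| `^ (4 / 3)) `^ (3 / 2)) `^ (2 / 3)) / 2.
Proof.
have h25 : 0 < (2 / 5 : R) by lra.
have h35 : 0 < (3 / 5 : R) by lra.
have e : (2 / 5 + 3 / 5 : R) = 1 by field.
have e' : (3 / 5 + 2 / 5 : R) = 1 by field.
have e1 : (4 / 5 : R) = 2 * (2 / 5) by field.
have e2 : (4 / 5 : R) = 4 / 3 * (3 / 5) by field.
have e3 : (2 / 5 : R) = 2 / 3 * (3 / 5) by field.
have e4 : (3 / 5 : R) = 3 / 2 * (2 / 5) by field.
have inner j : \sum_k `|a j k| `^ (8 / 5) <=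
    (\sum_k `|a j k| `^ 2) `^ (2 / 5) * (\sum_k `|a j k| `^ (4 / 3)) `^ (3 / 5).
  apply: le_trans (hoelder_powR _ _ h25 h35 e e1 e2).
  apply: ler_sum => k _; rewrite -powRD; last by apply/implyP; lra.
  by rewrite (_ : 8 / 5 = 4 / 5 + 4 / 5) //; field.
apply: le_trans (powR_mean _ _); last 2 first.
- by apply: sumr_ge0 => j _; exact: powR_ge0.
- by apply: sumr_ge0 => j _; exact: powR_ge0.
apply: le_powR; first lra.
  by apply: sumr_ge0 => j _; apply: sumr_ge0 => k _; exact: powR_ge0.
apply: le_trans (hoelder_powR _ _ h35 h25 e' e3 e4).
by apply: ler_sum => j _; exact: inner.
Qed.

Lemma trilinear_43_85_85 (I J K : finType) (a : I -> J -> K -> R) (M : R) :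
  bounded_form a M ->
  \sum_i (\sum_j \sum_k `|a i j k| `^ (8 / 5)) `^ (5 / 6) <= 2 * M `^ (4 / 3).
Proof.
move=> H.
apply: le_trans (ler_sum _ (fun i _ => mixed_interp (a i))) _.
rewrite -mulr_suml big_split /= ler_pdivrMr // mulr_natr mulr2n.
by apply: lerD; [exact: trilinear_43_43_2|exact: trilinear_43_2_43].
Qed.

End Forms.

(** * Trilinear forms *)

Section Trilinear.
Context {R : realType} {n : nat}.
Implicit Types (x y w v : 'rV[R]_n) (T : ('I_3 -> 'rV[R]_n) -> R).

Lemma row_norm_le x (c : R) : 0 <= c -> (forall i, `|x 0 i| <= c) -> `|x| <= c.
Proof.
move=> c0 xc; rewrite /Num.norm /= mx_normrE; apply: bigmax_le => // -[i j] _ /=.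
by rewrite (ord1 i).
Qed.

Lemma entry_le_row_norm x i : `|x 0 i| <= `|x|.
Proof.
rewrite [in leRHS]/Num.norm /= mx_normrE.
exact: (le_bigmax 0 (fun ij : 'I_1 * 'I_n => `|x ij.1 ij.2|) (0, i)).
Qed.

Lemma scalar_row (f : 'rV[R]_n -> R) x : scalar f ->
  f x = \sum_i x 0 i * f (delta_mx 0 i).
Proof.
move=> lf; have f0 : f 0 = 0.
  have := lf 1 0 0; rewrite scaler0 addr0 mul1r; lra.
rewrite {1}[x]row_sum_delta; elim/big_rec2: _ => // i a u _ <-.
by rewrite lf.
Qed.

Definition vec3 x y w : 'I_3 -> 'rV[R]_n := tnth [tuple x; y; w].

Lemma vec3_eta (z : 'I_3 -> 'rV[R]_n) :
  z = vec3 (z 0) (z 1) (z ord_max).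
Proof.
apply/funext => -[[|[|[|//]]] i3]; rewrite /vec3 (tnth_nth 0) /=;
  by congr (z _); apply: val_inj.
Qed.

Lemma dfwith_vec3 x y w v :
  [/\ @dfwith _ (fun=> 'rV[R]_n) (vec3 x y w) 0 v = vec3 v y w,
      @dfwith _ (fun=> 'rV[R]_n) (vec3 x y w) 1 v = vec3 x v w &
      @dfwith _ (fun=> 'rV[R]_n) (vec3 x y w) ord_max v = vec3 x y v].
Proof.
by split; rewrite [LHS]vec3_eta ?dfwithin ?dfwithout.
Qed.

Definition coef3 T (i j k : 'I_n) : R :=
  T (vec3 (delta_mx 0 i) (delta_mx 0 j) (delta_mx 0 k)).

Lemma multilinear_vec3 T x y w : multilinear_form T ->
  T (vec3 x y w) = \sum_i \sum_j \sum_k coef3 T i j k * x 0 i * y 0 j * w 0 k.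
Proof.
move=> mT.
have l0 y' w' : scalar (fun v => T (vec3 v y' w')).
  move=> a u v; have := mT 0 (vec3 0 y' w') a u v.
  by have [-> _ _] := dfwith_vec3 0 y' w' (a *: u + v);
     have [-> _ _] := dfwith_vec3 0 y' w' u; have [-> _ _] := dfwith_vec3 0 y' w' v.
have l1 x' w' : scalar (fun v => T (vec3 x' v w')).
  move=> a u v; have := mT 1 (vec3 x' 0 w') a u v.
  by have [_ -> _] := dfwith_vec3 x' 0 w' (a *: u + v);
     have [_ -> _] := dfwith_vec3 x' 0 w' u; have [_ -> _] := dfwith_vec3 x' 0 w' v.
have l2 x' y' : scalar (fun v => T (vec3 x' y' v)).
  move=> a u v; have := mT ord_max (vec3 x' y' 0) a u v.
  by have [_ _ ->] := dfwith_vec3 x' y' 0 (a *: u + v);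
     have [_ _ ->] := dfwith_vec3 x' y' 0 u; have [_ _ ->] := dfwith_vec3 x' y' 0 v.
rewrite (scalar_row x (l0 y w)); apply: eq_bigr => i _.
rewrite (scalar_row y (l1 _ w)) mulr_sumr; apply: eq_bigr => j _.
rewrite (scalar_row w (l2 _ _)) !mulr_sumr; apply: eq_bigr => k _.
by rewrite /coef3; ring.
Qed.

Lemma form_norm_ub T (z : 'I_3 -> 'rV[R]_n) : multilinear_form T ->
  (forall k, `|z k| <= 1) -> `|T z| <= form_norm T.
Proof.
move=> mT z1; apply: ub_le_sup; last by exists z.
(* The supremum is an upper bound only once the set is known to be bounded; the sum of the absolute
   coefficients bounds it. *)
exists (\sum_i \sum_j \sum_k `|coef3 T i j k|) => _ [z' z'1 <-].
rewrite [z']vec3_eta multilinear_vec3 //.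
have z'e k i : `|z' k 0 i| <= 1 by apply: le_trans (z'1 k); exact: entry_le_row_norm.
apply: le_trans (ler_norm_sum _ _ _) _; apply: ler_sum => i _.
apply: le_trans (ler_norm_sum _ _ _) _; apply: ler_sum => j _.
apply: le_trans (ler_norm_sum _ _ _) _; apply: ler_sum => k _.
by rewrite !normrM -!mulrA ler_piMr // ?mulr_ile1 ?mulr_ge0.
Qed.

Lemma form_norm_bounded T : multilinear_form T ->
  bounded_form (coef3 T) (form_norm T).
Proof.
move=> mT e e' e'' e1 e'1 e''1.
pose row (f : 'I_n -> R) : 'rV[R]_n := \row_i f i.
have row1 f : (forall i, `|f i| <= 1) -> `|row f| <= 1.
  by move=> f1; apply: row_norm_le => // i; rewrite mxE.
apply: le_trans (form_norm_ub mT (z := vec3 (row e) (row e') (row e'')) _).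
  rewrite multilinear_vec3 // le_eqVlt; apply/orP; left; apply/eqP; congr `|_|.
  apply: eq_bigr => i _; apply: eq_bigr => j _; apply: eq_bigr => k _.
  by rewrite !mxE.
by move=> -[[|[|[|//]]] i3]; rewrite /vec3 (tnth_nth 0) /= row1.
Qed.

Lemma canonical_coef3 T i j k : canonical_coef T [tuple i; j; k] = coef3 T i j k.
Proof.
rewrite /canonical_coef /coef3; congr T; rewrite [LHS]vec3_eta.
by congr vec3; congr delta_mx; rewrite (tnth_nth i).
Qed.

Lemma mixed_sum_cons m q1 (q : m.-tuple R) (a : m.+1.-tuple 'I_n -> R) :
  mixed_sum (cons_tuple q1 q) a = \sum_(j < n)
    mixed_sum q (fun t : m.-tuple 'I_n => a (cons_tuple j t)) `^ (q1 / head 1 q).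
Proof.
apply: eq_bigr => j _.
have -> : thead (cons_tuple q1 q) = q1 by [].
have -> // : behead_tuple (cons_tuple q1 q) = q by exact: val_inj.
Qed.

Lemma mixed_norm3E (q : 3.-tuple R) q1 q2 q3 T : tval q = [:: q1; q2; q3] ->
  mixed_norm q (canonical_coef T) =
  (\sum_i (\sum_j (\sum_k `|coef3 T i j k| `^ q3) `^ (q2 / q3)) `^ (q1 / q2)) `^ q1^-1.
Proof.
move=> Eq.
have -> : q = cons_tuple q1 (cons_tuple q2 (cons_tuple q3 [tuple])) by exact: val_inj.
have E1 i j : mixed_sum (cons_tuple q3 [tuple])
    (fun t => canonical_coef T (cons_tuple i (cons_tuple j t))) =
    \sum_k `|coef3 T i j k| `^ q3.
  rewrite mixed_sum_cons; have -> : head 1 [tuple] = 1 :> R by [].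
  apply: eq_bigr => k _; rewrite divr1 -canonical_coef3 /mixed_sum.
  have -> // : [tuple i; j; k] = cons_tuple i (cons_tuple j (cons_tuple k [tuple])).
  exact: val_inj.
have E2 i : mixed_sum (cons_tuple q2 (cons_tuple q3 [tuple]))
    (fun t => canonical_coef T (cons_tuple i t)) =
    \sum_j (\sum_k `|coef3 T i j k| `^ q3) `^ (q2 / q3).
  rewrite mixed_sum_cons; have -> : head 1 (cons_tuple q3 [tuple]) = q3 by [].
  by apply: eq_bigr => j _; rewrite E1.
have E3 : mixed_sum (cons_tuple q1 (cons_tuple q2 (cons_tuple q3 [tuple])))
    (canonical_coef T) =
    \sum_i (\sum_j (\sum_k `|coef3 T i j k| `^ q3) `^ (q2 / q3)) `^ (q1 / q2).
  rewrite mixed_sum_cons.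
  have -> : head 1 (cons_tuple q2 (cons_tuple q3 [tuple])) = q2 by [].
  by apply: eq_bigr => i _; rewrite E2.
by rewrite /mixed_norm E3.
Qed.

End Trilinear.

(** * The extremal form and the lower bound *)

Section Extremal.
Context {R : realType}.

(** The left side equals twice the maximum of [|s|] and [|t|]. *)
Lemma norm_sum_diff_le2 (s t : R) : `|s| <= 1 -> `|t| <= 1 ->
  `|s + t| + `|s - t| <= 2.
Proof.
rewrite !ler_norml => /andP[? ?] /andP[? ?].
by case: (ger0P (s + t)) => ?; case: (ger0P (s - t)) => ?; lra.
Qed.

(** The form of the 2 by 2 Hadamard matrix, which attains the constant 2^(1/2) in Littlewood's
    inequality. *)
Definition littlewood_form (x0 x1 y0 y1 : R) : R := x0 * (y0 + y1) + x1 * (y0 - y1).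

Lemma littlewood_form_le2 (x0 x1 y0 y1 : R) :
  `|x0| <= 1 -> `|x1| <= 1 -> `|y0| <= 1 -> `|y1| <= 1 ->
  `|littlewood_form x0 x1 y0 y1| <= 2.
Proof.
move=> hx0 hx1 hy0 hy1; apply: le_trans (norm_sum_diff_le2 hy0 hy1).
apply: le_trans (ler_normD _ _) _; rewrite !normrM.
by apply: lerD; rewrite ler_piMl.
Qed.

(** Two disjoint Littlewood blocks, each multiplied by two equal coefficients up to sign, the
    equality case of Khinchine. *)
Definition extremal_form (z : 'I_3 -> 'rV[R]_4) : R :=
  let x i := z 0 0 (inord i) in let y i := z 1 0 (inord i) in
  let w i := z ord_max 0 (inord i) in
  (w 0 + w 1) * littlewood_form (x 0) (x 1) (y 0) (y 1) +
  (w 0 - w 1) * littlewood_form (x 2) (x 3) (y 2) (y 3).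

Lemma extremal_multilinear : multilinear_form extremal_form.
Proof.
move=> k z a u v; rewrite /extremal_form /littlewood_form.
have [->|->|->] : [\/ k = 0, k = 1 | k = ord_max].
  by case: k => [[|[|[|//]]] k3];
    [apply: Or31|apply: Or32|apply: Or33]; exact: val_inj.
- by rewrite !dfwithin !dfwithout // !mxE; ring.
- by rewrite !dfwithin !dfwithout // !mxE; ring.
- by rewrite !dfwithin !dfwithout // !mxE; ring.
Qed.

Lemma extremal_norm : form_norm extremal_form <= 4.
Proof.
apply: ge_sup.
  exists `|extremal_form (fun=> 0)|; exists (fun=> 0) => // k.
  by rewrite normr0.
move=> _ [z z1 <-].
have ze k i : `|z k 0 i| <= 1 by apply: le_trans (z1 k); exact: entry_le_row_norm.
apply: le_trans (ler_normD _ _) _; rewrite !normrM.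
have -> : 4 = 2 * 2 :> R by lra.
apply: (@le_trans _ _ (`|z ord_max 0 (inord 0) + z ord_max 0 (inord 1)| * 2 +
   `|z ord_max 0 (inord 0) - z ord_max 0 (inord 1)| * 2)).
  by apply: lerD; rewrite ler_wpM2l // littlewood_form_le2 ?ze.
by rewrite -mulrDl ler_wpM2r // norm_sum_diff_le2 ?ze.
Qed.

Lemma extremal_coef (i j k : 'I_4) :
  `|coef3 extremal_form i j k| =
    if (((i < 2) == (j < 2)) && (k < 2))%N then 1 else 0.
Proof.
rewrite /coef3 /extremal_form /littlewood_form /vec3 !(tnth_nth 0) /= !mxE !eqxx /=.
rewrite -!val_eqE /= !inordK //.
case: i j k => [[|[|[|[|//]]]] i4] [[|[|[|[|//]]]] j4] [[|[|[|[|//]]]] k4] /=;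
  rewrite ?(mulr0, mul0r, addr0, add0r, subr0, sub0r, mulr1, mul1r, normrN, normr1,
    normr0, mulrN, mulNr, oppr0) //.
Qed.

Lemma if_powR (b : bool) (c r : R) : r != 0 ->
  (if b then c else 0) `^ r = if b then c `^ r else 0.
Proof. by move=> r0; case: b; rewrite // powR0. Qed.

(** All nonzero coefficients are 1 or -1: there are 4 choices of i, then 2 of j in the same block,
    then 2 of k. *)
Lemma extremal_mixed_norm (q : 3.-tuple R) (q1 q2 q3 : R) :
  0 < q1 -> 0 < q2 -> 0 < q3 -> tval q = [:: q1; q2; q3] ->
  mixed_norm q (canonical_coef extremal_form) = 2 `^ (2 / q1 + q2^-1 + q3^-1).
Proof.
move=> q1p q2p q3p Eq; rewrite (mixed_norm3E _ Eq).
have n1 := lt0r_neq0 q1p; have n2 := lt0r_neq0 q2p; have n3 := lt0r_neq0 q3p.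
have Ek i j : \sum_k `|coef3 extremal_form i j k| `^ q3 =
    if ((i < 2) == (j < 2))%N then 2 else 0.
  transitivity (\sum_(k < 4) if (((i < 2) == (j < 2)) && (k < 2))%N then 1 else 0 : R).
    by apply: eq_bigr => k _; rewrite extremal_coef if_powR // powR1.
  by rewrite !big_ord_recl big_ord0; case: (_ == _); rewrite /= !addr0.
have Ej i : \sum_j (\sum_k `|coef3 extremal_form i j k| `^ q3) `^ (q2 / q3) =
    2 `^ (1 + q2 / q3).
  transitivity (\sum_(j < 4) if ((i < 2) == (j < 2))%N then 2 `^ (q2 / q3) else 0).
    by apply: eq_bigr => j _; rewrite Ek if_powR // mulf_neq0 // invr_neq0.
  rewrite powRD; last by apply/implyP; rewrite pnatr_eq0.
  rewrite powRr1 // !big_ord_recl big_ord0.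
  by case: (i < 2)%N; rewrite /= !addr0 ?add0r -mulr2n mulr_natl.
have Ei : \sum_i (\sum_j (\sum_k `|coef3 extremal_form i j k| `^ q3) `^ (q2 / q3))
      `^ (q1 / q2) = 2 `^ (2 + (1 + q2 / q3) * (q1 / q2)).
  transitivity (\sum_(i < 4) 2 `^ ((1 + q2 / q3) * (q1 / q2)) : R).
    by apply: eq_bigr => i _; rewrite Ej -powRrM.
  rewrite sumr_const card_ord powRD; last by apply/implyP; rewrite pnatr_eq0.
  have -> : 2 `^ 2 = 4 :> R by rewrite powR_mulrn // -natrX.
  by rewrite mulr_natl.
rewrite Ei -powRrM; congr (_ `^ _); field.
by rewrite n1 n2 n3.
Qed.

Lemma extremal_lower_bound (q : 3.-tuple R) (q2 q3 C : R) :
  0 < q2 -> 0 < q3 -> q2^-1 + q3^-1 = 5 / 4 -> tval q = [:: 4 / 3; q2; q3] ->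
  BH_constant q C -> 2 `^ (3 / 4) <= C.
Proof.
move=> q2p q3p q23 Eq [C1 /(_ 4%N extremal_form isT extremal_multilinear)].
rewrite (extremal_mixed_norm _ q2p q3p Eq); last by lra.
(* The summand 2 accounts for the norm 4 of the form. *)
have -> : 2 / (4 / 3) + q2^-1 + q3^-1 = 3 / 4 + 2 by rewrite -addrA q23; field.
rewrite powRD; last by apply/implyP; rewrite pnatr_eq0.
rewrite (powR_mulrn 2) // => h.
have := le_trans h (ler_wpM2l (le_trans ler01 C1) extremal_norm).
by move: (2 `^ _) => x; lra.
Qed.

End Extremal.

(** * The upper bound for the three exponents *)

Section UpperBound.
Context {R : realType}.

Lemma root43_le (S N : R) : 0 <= S -> 0 <= N -> S <= 2 * N `^ (4 / 3) ->
  S `^ (4 / 3)^-1 <= 2 `^ (3 / 4) * N.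
Proof.
move=> S0 N0 SN.
have -> : 2 `^ (3 / 4) * N = (2 * N `^ (4 / 3)) `^ (4 / 3)^-1.
  rewrite powRM ?powR_ge0 // -powRrM mulfV ?powRr1 //.
  by apply: (congr1 (fun r => 2 `^ r * N)); field.
by apply: le_powR => //; rewrite invr_ge0; lra.
Qed.

Lemma form_norm_ge0 (n : nat) (T : ('I_3 -> 'rV[R]_n) -> R) :
  multilinear_form T -> 0 <= form_norm T.
Proof.
move=> mT; apply: le_trans (form_norm_ub mT (z := fun=> 0) _) => // k.
by rewrite normr0.
Qed.

(** All three exponents begin with 4/3, so each array bound [2 * M^(4/3)] only has to be raised to
    the power 3/4. *)
Lemma BH_constant_43 (q : 3.-tuple R) (q2 q3 : R) :
  tval q = [:: 4 / 3; q2; q3] ->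
  (forall (n : nat) (a : 'I_n -> 'I_n -> 'I_n -> R) (M : R), bounded_form a M ->
     \sum_i (\sum_j (\sum_k `|a i j k| `^ q3) `^ (q2 / q3)) `^ (4 / 3 / q2)
       <= 2 * M `^ (4 / 3)) ->
  BH_constant q (2 `^ (3 / 4)).
Proof.
move=> Eq H; split.
  by rewrite -[X in X <= _](powRr0 2) ler_powR ?ler1n //; lra.
move=> n T n0 mT; rewrite (mixed_norm3E _ Eq).
apply: root43_le; first by apply: sumr_ge0 => i _; exact: powR_ge0.
  exact: form_norm_ge0.
by apply: H; exact: form_norm_bounded.
Qed.

Lemma BH_constant_43_43_2 (q : 3.-tuple R) :
  tval q = [:: 4 / 3; 4 / 3; 2] -> BH_constant q (2 `^ (3 / 4)).
Proof.
move=> Eq; apply: (BH_constant_43 Eq) => n a M H.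
have -> : 4 / 3 / (4 / 3) = 1 :> R by field.
have -> : 4 / 3 / 2 = 2 / 3 :> R by field.
apply: le_trans (trilinear_43_43_2 H); apply: ler_sum => i _.
by rewrite powRr1 // sumr_ge0 // => j _; exact: powR_ge0.
Qed.

Lemma BH_constant_43_2_43 (q : 3.-tuple R) :
  tval q = [:: 4 / 3; 2; 4 / 3] -> BH_constant q (2 `^ (3 / 4)).
Proof.
move=> Eq; apply: (BH_constant_43 Eq) => n a M H.
have -> : 2 / (4 / 3) = 3 / 2 :> R by field.
have -> : 4 / 3 / 2 = 2 / 3 :> R by field.
exact: trilinear_43_2_43.
Qed.

Lemma BH_constant_43_85_85 (q : 3.-tuple R) :
  tval q = [:: 4 / 3; 8 / 5; 8 / 5] -> BH_constant q (2 `^ (3 / 4)).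
Proof.
move=> Eq; apply: (BH_constant_43 Eq) => n a M H.
have -> : 8 / 5 / (8 / 5) = 1 :> R by field.
have -> : 4 / 3 / (8 / 5) = 5 / 6 :> R by field.
apply: le_trans (trilinear_43_85_85 H); apply: ler_sum => i _.
apply: le_powR; first lra.
  by apply: sumr_ge0 => j _; exact: powR_ge0.
apply: ler_sum => j _.
by rewrite powRr1 // sumr_ge0 // => k _; exact: powR_ge0.
Qed.

End UpperBound.

Unset Implicit Arguments.

Theorem theorem5p2 (R : realType) (q : 3.-tuple R)
    (hq : tval q = [:: 4 / 3; 4 / 3; 2] \/
          tval q = [:: 4 / 3; 8 / 5; 8 / 5] \/
          tval q = [:: 4 / 3; 2; 4 / 3]) :
  optimal_BH_constant q (2 `^ (3 / 4)).
Proof.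
case: hq => [Eq|[Eq|Eq]]; split.
- exact: BH_constant_43_43_2.
- by move=> C; apply: (extremal_lower_bound _ _ _ Eq); lra.
- exact: BH_constant_43_85_85.
- by move=> C; apply: (extremal_lower_bound _ _ _ Eq); lra.
- exact: BH_constant_43_2_43.
- by move=> C; apply: (extremal_lower_bound _ _ _ Eq); lra.
Qed.
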